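(* The number of positive integers $m\le x$ for which there exists an integer $k\ge 2$ with $$1^k+2^k+\dots+(m-1)^k=m^k$$ is $O(\log x)$ as $x$ tends to infinity.
   Context: For each integer $m\ge2$ there is at most one real $k$ satisfying the equation, so counting the values $m\le x$ is the same as counting the solutions $(m,k)$ with $m\le x$. *)

(* Defs.v *)
From HB Require Import structures.
From mathcomp Require Export all_boot all_order all_algebra.
From mathcomp Require Export finmap all_classical all_reals all_analysis.
Export numFieldNormedType.Exports.

Set Implicit Arguments.
Unset Strict Implicit.
Unset Printing Implicit Defensive.

Import Order.TTheory GRing.Theory Num.Theory.

Local Open Scope classical_set_scope.
Local Open Scope ring_scope.

(* Needed for [f =O_ (+oo_ R) g]: [pinfty_nbhs] is only an instance of the
   [ProperFilter] class in the library, not a canonical [filter_on]. *)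
Canonical pinfty_filter_on (R : numFieldType) : filter_on R :=
  FilterType (pinfty_nbhs R) _.

Definition erdos_moser (m k : nat) : Prop :=
  (\sum_(1 <= j < m) j ^ k = m ^ k)%N.

Definition moser_upto (R : realType) (x : R) : set nat :=
  [set m : nat | [/\ (0 < m)%N, m%:R <= x
                   & exists k : nat, (2 <= k)%N /\ erdos_moser m k]].

(* [fset_set] is the empty set on infinite sets; this shows that the
   cardinality taken in [moser_count] is the true one. *)
Lemma finite_moser_upto (R : realType) (x : R) : finite_set (moser_upto x).
Proof.
apply: (@sub_finite_set _ _ `I_(Num.truncn x).+1); last exact: finite_II.
move=> m [_ mx _] /=; rewrite -(@ltr_nat R).
by apply: le_lt_trans mx _; exact: truncnS_gt.
Qed.

Definition moser_count (R : realType) (x : R) : nat :=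
  #|` fset_set (moser_upto x)|.

(* Main.v *)
(* Put n = 1/m, kap = k/m and rho = ln 2 - kap. Reversing the sum, a solution
   satisfies sum_(0 < j < m) (1 - j n)^k = 1, and the j-th term is close to
   exp(- kap j) = 2^(-j) exp(rho j). Comparing with the geometric series gives
   0 <= rho = O(n); expanding each term to order n^3 and summing the moments
   sum_j j^a / 2^j = 1, 2, 6, 26, 150 then yields
     k = ln 2 (m - 3/2) - sig / m + O(1/m^2),  sig = ln 2 (25/12 - 3 ln 2) > 0.
   For two solutions m <= m' <= 2 m the integer 2k(2m' - 3) - 2k'(2m - 3) is
   -2 sig ((2m'-3)/m - (2m-3)/m') + O(1/m), which is less than 1 in absolute
   value for large m because sig is small; so it vanishes, which forces
   m' - m = O(1). Hence each dyadic interval contains O(1) solutions. *)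
Require Import Defs.
From mathcomp Require Import ring lra zify.
Set Implicit Arguments.
Unset Strict Implicit.
Unset Printing Implicit Defensive.
Import Order.TTheory GRing.Theory Num.Theory.
Local Open Scope classical_set_scope.
Local Open Scope ring_scope.

(** * Explicit Taylor bounds for exp and ln *)

(** The condition [0 <= c * x] keeps [c] on the same side of 0 as [x], so that one statement serves
    both signs of [x]. *)
Lemma mean_value0 (R : realType) (f df : R -> R) (x : R) :
  (forall y : R, is_derive y (1 : R) f (df y)) ->
  exists c, 0 <= c * x /\ f x - f 0 = df c * x.
Proof.
move=> fdf.
have cf (a b : R) : {within `[a, b], continuous f}.
  by apply: derivable_within_continuous => y _; case: (fdf y).
have [x0|x0] := leP 0 x.
  have [c] := MVT_segment x0 (fun y _ => fdf y) (cf _ _).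
  rewrite in_itv /= => /andP[c0 cx]; rewrite subr0 => ->.
  by exists c; split=> //; rewrite mulr_ge0.
have [c] := MVT_segment (ltW x0) (fun y _ => fdf y) (cf _ _).
rewrite in_itv /= => /andP[c0 cx] E.
exists c; split; first by rewrite mulr_le0 // ltW.
by rewrite -opprB E; ring.
Qed.

(** The remainder [g] after the quadratic term vanishes at 0 and has derivative
    [expR y - (1 + y) >= 0], so it has the sign of its argument. Since [g] is in turn the derivative
    of the remainder after the cubic term, that remainder is least at 0. *)
Lemma expR_ge_cubic (R : realType) (x : R) :
  1 + x + x ^+ 2 / 2 + x ^+ 3 / 6 <= expR x.
Proof.
pose g (y : R) := expR y - (1 + y + y ^+ 2 / 2).
have dg (y : R) : is_derive y 1 g (expR y - (1 + y)).
  by apply: is_derive_eq; rewrite /GRing.scale /=; field.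
have dh (y : R) : is_derive y 1 (fun y => g y - y ^+ 3 / 6) (g y).
  by apply: is_derive_eq; rewrite /g /GRing.scale /=; field.
have g0 : g 0 = 0 by rewrite /g expR0; ring.
have g_sign (y : R) : 0 <= y * g y.
  have [c [_]] := mean_value0 y dg.
  rewrite g0 subr0 => ->.
  have -> : y * ((expR c - (1 + c)) * y) = (expR c - (1 + c)) * y ^+ 2 by ring.
  by rewrite mulr_ge0 ?sqr_ge0 // subr_ge0 expR_ge1Dx.
have [c [cx]] := mean_value0 x dh.
rewrite g0 /g => E.
suff : 0 <= g c * x by rewrite -/(g c) in E *; lra.
have [->|c0] := eqVneq c 0; first by rewrite g0 mul0r.
(* The factor [c ^+ 2] makes the claim a product of [c * g c] and [c * x], both nonnegative. *)
rewrite -(@pmulr_lge0 _ (c ^+ 2)) ?exprn_even_gt0 //.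
have -> : g c * x * c ^+ 2 = (c * g c) * (c * x) by ring.
by rewrite mulr_ge0.
Qed.

(** Lower bounds come from the cubic bound at [v]; upper bounds, apart from the crude case [v > 1],
    come from the cubic bound at [- v] through [expR v * expR (- v) = 1]. *)
Lemma expR_taylor2 (R : realType) (v : R) :
  `|expR v - (1 + v + v ^+ 2 / 2)| <= `|v| ^+ 3 * Num.max 1 (expR v).
Proof.
have H := expR_ge_cubic v.
have H' := expR_ge_cubic (- v).
have E : expR v * expR (- v) = 1 by rewrite -expRD subrr expR0.
have e0 := expR_gt0 v; have e0' := expR_gt0 (- v).
rewrite ler_norml.
have [v0|v0] := leP 0 v.
  rewrite ger0_norm //.
  have e1 : 1 <= expR v by rewrite -[leLHS]expR0 ler_expR.
  have v3 : 0 <= v ^+ 3 by exact: exprn_ge0.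
  have ve : 0 <= v ^+ 3 * expR v by rewrite mulr_ge0 // ltW.
  rewrite max_r //; apply/andP; split; first by lra.
  have [v1|v1] := leP v 1; last first.
    have : expR v <= v ^+ 3 * expR v by rewrite ler_peMl ?exprn_ege1 // ltW.
    by nra.
  suff : 1 - expR (- v) * (1 + v + v ^+ 2 / 2) <= v ^+ 3.
    move=> /(ler_wpM2r (ltW e0)).
    rewrite mulrBl mul1r mulrAC [expR (- v) * _]mulrC E; lra.
  have : (1 + - v + (- v) ^+ 2 / 2 + (- v) ^+ 3 / 6) * (1 + v + v ^+ 2 / 2)
    <= expR (- v) * (1 + v + v ^+ 2 / 2) by apply: ler_wpM2r => //; nra.
  have : 0 <= v ^+ 3 * (5 / 6 + v / 12 - v ^+ 2 / 12).
    by rewrite mulr_ge0 //; nra.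
  lra.
rewrite ltr0_norm //.
have e1 : expR v <= 1 by rewrite -[leRHS]expR0 ler_expR ltW.
rewrite max_l //.
have v3 : 0 <= (- v) ^+ 3 by apply: exprn_ge0; lra.
rewrite mulr1; apply/andP; split; first by lra.
set u := - v in H' E e0' v3 *.
have u0 : 0 < u by rewrite /u; lra.
have -> : v = - u by rewrite /u; ring.
rewrite lerBlDr; set q := (X in _ <= X).
have : 1 <= q * expR u.
  apply: (@le_trans _ _ (q * (1 + u + u ^+ 2 / 2 + u ^+ 3 / 6))).
    have -> : q * (1 + u + u ^+ 2 / 2 + u ^+ 3 / 6) = 1 + u ^+ 4 / 4
      + u ^+ 3 / 6 * (1 - u + u ^+ 2 / 2)
      + u ^+ 3 * (u + u ^+ 2 / 2 + u ^+ 3 / 6) + u ^+ 3.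
      by rewrite /q; field.
    have u3 : 0 < u ^+ 3 by rewrite exprn_gt0.
    have u4 : 0 < u ^+ 4 by rewrite exprn_gt0.
    have : 0 <= u ^+ 3 * (1 - u + u ^+ 2 / 2).
      by rewrite mulr_ge0 // ?ltW //; nra.
    have : 0 <= u ^+ 3 * (u + u ^+ 2 / 2 + u ^+ 3 / 6).
      by rewrite mulr_ge0 // ?ltW //; nra.
    lra.
  apply: ler_wpM2l => //.
  by rewrite /q; nra.
have -> : expR (- u) = expR v by rewrite /u opprK.
move=> /(ler_wpM2l (ltW e0)).
by rewrite mulr1 mulrCA E mulr1.
Qed.

(** The remainder has derivative [y ^+ 3 / (1 - y)], at most [2 * t ^+ 3] on [[0, t]]; the mean
    value theorem supplies the last factor [t]. *)
Lemma ln_taylor3 (R : realType) (t : R) : 0 <= t <= 1 / 2 ->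
  0 <= - ln (1 - t) - (t + t ^+ 2 / 2 + t ^+ 3 / 3) <= 2 * t ^+ 4.
Proof.
move=> /andP[t0 t2].
pose f (y : R) := - ln (1 - y) - (y + y ^+ 2 / 2 + y ^+ 3 / 3).
have df (y : R) : y < 1 -> is_derive y 1 f (y ^+ 3 / (1 - y)).
  move=> y1; have y1' : 0 < 1 - y by lra.
  have dln : is_derive (1 - y) 1 (@ln R) (1 - y)^-1 := is_derive1_ln y1'.
  by apply: is_derive_eq; rewrite /GRing.scale /=; field; lra.
have cf : {within `[0, t], continuous f}.
  apply: derivable_within_continuous => y; rewrite in_itv /= => /andP[_ yt].
  by case: (df y) => //; lra.
have df' (y : R) : y \in `]0, t[ -> is_derive y 1 f (y ^+ 3 / (1 - y)).
  by rewrite in_itv /= => /andP[_ yt]; apply: df; lra.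
have [c] := MVT_segment t0 df' cf.
rewrite in_itv /= => /andP[c0 ct].
have -> : f 0 = 0 by rewrite /f subr0 ln1; ring.
rewrite !subr0 -/(f t) => ->.
have c1 : 0 < 1 - c by lra.
have i1 : (1 - c)^-1 <= 2.
  by rewrite -[leRHS]invrK lef_pV2 ?posrE ?invr_gt0 //; lra.
have i0 : 0 <= (1 - c)^-1 by rewrite invr_ge0 ltW.
have c3 : 0 <= c ^+ 3 by rewrite exprn_ge0.
apply/andP; split; first by rewrite !mulr_ge0.
have -> : 2 * t ^+ 4 = t ^+ 3 * 2 * t by ring.
apply: ler_wpM2r => //; apply: ler_pM => //.
by rewrite ler_pXn2r // nnegrE.
Qed.

(** The affine function [25 / 12 - 3 * x] is 0 at [25 / 36] and [1 / 12] at [2 / 3]; these bounds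
    thus place [ln 2 * (25 / 12 - 3 * ln 2)] in the range that the gap argument requires. *)
Lemma ln2_bounds (R : realType) : 2 / 3 <= ln (2 : R) < 25 / 36.
Proof.
have H := @expR_ge_cubic R (- (2 / 3)).
have H' := @expR_ge_cubic R (25 / 72).
have p2 : (2 : R) \is Num.pos by rewrite posrE.
apply/andP; split.
  rewrite -ler_expR lnK //.
  have E : expR (2 / 3 : R) * expR (- (2 / 3)) = 1 by rewrite -expRD subrr expR0.
  have := expR_gt0 (2 / 3 : R); nra.
rewrite -ltr_expR lnK //.
(* The cubic bound at [25 / 36] falls just short of 2, while the square of the one at [25 / 72]
   exceeds it. *)
have -> : (25 / 36 : R) = 25 / 72 + 25 / 72 by field.
rewrite expRD; nra.
Qed.

(** * Sums of powers against decaying exponentials *)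

Lemma pow_le_expR (R : realType) (a : nat) (d : R) : 0 < d ->
  exists2 c : R, 0 < c & forall x, 0 <= x -> x ^+ a <= c * expR (d * x).
Proof.
elim: a d => [|a IHa] d d0.
  exists 1 => // x x0.
  by rewrite expr0 mul1r -[leLHS]expR0 ler_expR mulr_ge0 // ltW.
have d2 : 0 < d / 2 by lra.
have [c c0 Hc] := IHa _ d2.
exists (c * (d / 2)^-1) => [|x x0]; first by rewrite mulr_gt0 // invr_gt0.
have -> : d * x = d / 2 * x + d / 2 * x by field.
rewrite exprS expRD mulrACA mulrC.
apply: ler_pM; rewrite ?exprn_ge0 //; first exact: Hc.
rewrite ler_pdivlMl //.
have := expR_ge1Dx (d / 2 * x); lra.
Qed.

(** Half of the decay absorbs the power of [j]; the other half leaves a convergent geometric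
    series. *)
Lemma sum_pow_expR_bounded (R : realType) (a : nat) (d : R) : 0 < d ->
  exists2 G : R, 0 < G &
    forall N, \sum_(1 <= j < N) j%:R ^+ a * expR (- (d * j%:R)) <= G.
Proof.
move=> d0; have d2 : 0 < d / 2 by lra.
have [c c0 Hc] := pow_le_expR a d2.
pose q : R := expR (- (d / 2)).
have q0 : 0 < q by exact: expR_gt0.
have q1 : 0 < 1 - q by rewrite subr_gt0 -[ltRHS]expR0 ltr_expR; lra.
exists (c / (1 - q)) => [|N]; first by rewrite divr_gt0.
have geo : \sum_(1 <= j < N) q ^+ j <= (1 - q)^-1.
  rewrite -[leRHS]mul1r ler_pdivlMr //.
  case: N => [|N]; first by rewrite big_geq // mul0r.
  have -> : (\sum_(1 <= j < N.+1) q ^+ j) * (1 - q) = q - q ^+ N.+1.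
    elim: N => [|N IHN]; first by rewrite big_geq // expr1 subrr mul0r.
    by rewrite big_nat_recr //= mulrDl IHN !exprS; ring.
  have := exprn_gt0 N.+1 q0; lra.
apply: le_trans (ler_wpM2l (ltW c0) geo).
rewrite mulr_sumr; apply: ler_sum => j _.
have -> : c * q ^+ j = c * expR (d / 2 * j%:R) * expR (- (d * j%:R)).
  rewrite -mulrA -expRD -expRM_natl; congr (_ * expR _); by field.
by apply: ler_wpM2r; [exact/ltW/expR_gt0 | exact: Hc].
Qed.

(** The polynomials in [N] are the shifted moments [sum_(i >= 1) (N + i)^a / 2^i], so the subtracted
    part is the tail of the full series beyond [N]. *)
Lemma sum_quartic_half (R : realType) (c0 c1 c2 c3 c4 : R) (N : nat) :
  \sum_(1 <= j < N.+1) (1 / 2) ^+ j * (c0 + c1 * j%:R + c2 * j%:R ^+ 2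
      + c3 * j%:R ^+ 3 + c4 * j%:R ^+ 4) =
  c0 + 2 * c1 + 6 * c2 + 26 * c3 + 150 * c4 - (1 / 2) ^+ N *
    (c0 + c1 * (N%:R + 2) + c2 * (N%:R ^+ 2 + 4 * N%:R + 6)
     + c3 * (N%:R ^+ 3 + 6 * N%:R ^+ 2 + 18 * N%:R + 26)
     + c4 * (N%:R ^+ 4 + 8 * N%:R ^+ 3 + 36 * N%:R ^+ 2 + 104 * N%:R + 150)).
Proof.
elim: N => [|N IHN]; first by rewrite big_geq // expr0; ring.
rewrite big_nat_recr //= IHN -[N.+1%:R]natr1 (exprS _ N).
by move: (_ ^+ N) (N%:R) => p x; field.
Qed.

(** * The normalized equation and the perturbation of one summand *)

Lemma erdos_moser_normalized (R : realType) (m k : nat) :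
  (0 < m)%N -> erdos_moser m k ->
  \sum_(1 <= j < m) (1 - j%:R / m%:R) ^+ k = 1 :> R.
Proof.
move=> m0 mk.
have m0' : (m%:R : R) != 0 by rewrite pnatr_eq0 -lt0n.
have : (\sum_(1 <= j < m) j ^ k)%N%:R / m%:R ^+ k = 1 :> R.
  by rewrite mk natrX divff // expf_neq0.
rewrite natr_sum mulr_suml big_nat_rev /= => S1; rewrite -[RHS]S1.
apply: eq_big_nat => j /andP[j1 jm].
rewrite natrX -expr_div_n; congr (_ ^+ _).
rewrite add1n subSS natrB ?(ltnW jm) //.
by rewrite mulrBl divff.
Qed.

(* For the j-th term, [t = j / m], [s = j^2 / m], [r = rho j], and [w] is the part
   of [- k ln (1 - t)] of order at least 4 in [t]. *)
Lemma expR_perturbation (R : realType) (K s t kap r w : R) :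
  1 <= K -> 0 <= t <= 1 / 2 -> t <= s -> 0 <= kap <= 1 -> 0 <= r <= K * t ->
  0 <= w <= 2 * s * t ^+ 2 ->
  `|expR (r - kap * s / 2 - kap * s * t / 3 - w) -
    (1 + (r - kap * s / 2) - kap * s * t / 3 + (r - kap * s / 2) ^+ 2 / 2)|
  <= 10 * (K + 2) ^+ 3 * s ^+ 3 * expR r.
Proof.
move=> K1 /andP[t0 t2] ts /andP[kap0 kap1] /andP[r0 rK] /andP[w0 wle].
have s0 : 0 <= s by lra.
have st0 : 0 <= s * t by rewrite mulr_ge0.
have ksst : kap * s * t <= s * t by rewrite -mulrA ler_piMl.
have ks0 : 0 <= kap * s by rewrite mulr_ge0.
have kst0 : 0 <= kap * s * t by rewrite mulr_ge0.
have kss : kap * s <= s by rewrite ler_piMl.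
have Ks : r <= K * s by apply: le_trans rK _; rewrite ler_wpM2l //; lra.
have sts : s * t <= s / 2 by rewrite ler_wpM2l //; lra.
have wst : w <= s * t by nra.
have st_s2 : s * t <= s ^+ 2 by nra.
have s3 : 0 <= s ^+ 3 by rewrite exprn_ge0.
have w_s3 : w <= 2 * s ^+ 3.
  apply: le_trans wle _; rewrite (exprS s) mulrA ler_wpM2l ?mulr_ge0 //.
  by rewrite ler_pXn2r // nnegrE.
(* [a] is the part of the exponent of order [s]; [b] collects the rest and is at most
   [2 * s ^+ 2]. *)
set a := r - _ / 2; set b := kap * s * t / 3 + w.
have -> : a - kap * s * t / 3 - w = a - b by rewrite /b; ring.
have a_ub : a <= K * s by rewrite /a; lra.
have a_lb : - s <= a by rewrite /a; lra.
have b0 : 0 <= b by rewrite /b; lra.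
have b_ub : b <= 2 * (s * t) by rewrite /b; lra.
have v_le : `|a - b| <= (K + 2) * s by rewrite ler_norml; apply/andP; split; nra.
have e1 : 1 <= expR r by rewrite -[leLHS]expR0 ler_expR.
have ev : expR (a - b) <= expR r by rewrite ler_expR /a; lra.
have taylor : `|expR (a - b) - (1 + (a - b) + (a - b) ^+ 2 / 2)|
    <= (K + 2) ^+ 3 * s ^+ 3 * expR r.
  apply: le_trans (expR_taylor2 _) _; rewrite -exprMn.
  apply: ler_pM; rewrite ?exprn_ge0 ?le_max ?ler01 //.
    by rewrite ler_pXn2r // nnegrE; apply: le_trans v_le.
  by rewrite ge_max e1 ev.
have sq : `|b * (b - 2 * a)| <= 2 * (2 * K + 3) * s ^+ 3.
  have : `|b - 2 * a| <= (2 * K + 3) * s.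
    by rewrite ler_norml; apply/andP; split; nra.
  have : `|b| <= 2 * s ^+ 2 by rewrite ger0_norm //; lra.
  move=> /ler_pM H /H{H}; rewrite -normrM => H.
  by apply: le_trans (H _ _) _ => //; rewrite exprS; lra.
(* The error is the Taylor remainder, plus [- w], plus the effect of [b] on the square. In units of
   [s ^+ 3 * expR r] these cost [(K + 2) ^+ 3], 2 and [2 * K + 3]. *)
have -> : expR (a - b) - (1 + a - kap * s * t / 3 + a ^+ 2 / 2) =
    (expR (a - b) - (1 + (a - b) + (a - b) ^+ 2 / 2))
    - w + b * (b - 2 * a) / 2 by rewrite /b; field.
have Kp : 0 <= (10 * (K + 2) ^+ 3 - (K + 2) ^+ 3 - (2 * K + 5)).
  have : 1 * (K + 2) <= (K + 2) ^+ 2 * (K + 2).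
    by apply: ler_wpM2r; [lra | rewrite exprn_ege1 //; lra].
  by rewrite -exprSr; lra.
have s3e : s ^+ 3 <= s ^+ 3 * expR r by rewrite ler_peMr.
have : (10 * (K + 2) ^+ 3 - (K + 2) ^+ 3 - (2 * K + 5)) * (s ^+ 3 * expR r) >= 0.
  by rewrite !mulr_ge0 // ltW ?expR_gt0.
have : (2 * K + 5) * s ^+ 3 <= (2 * K + 5) * (s ^+ 3 * expR r).
  by rewrite ler_wpM2l //; lra.
move: taylor sq; rewrite !ler_norml => /andP[? ?] /andP[? ?] ? ?.
by apply/andP; split; lra.
Qed.

(* The terms with [j >= m / 2], where [ln (1 - t)] has no useful expansion: there
   [s] is bounded below, so a crude bound on each summand is enough. *)
Lemma expR_perturbation_far (R : realType) (K s t kap r y : R) :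
  1 <= K -> 1 / 2 <= t <= 1 -> t <= s -> 0 <= kap <= 1 -> 0 <= r <= K * t ->
  0 <= y <= expR r ->
  `|y -
    (1 + (r - kap * s / 2) - kap * s * t / 3 + (r - kap * s / 2) ^+ 2 / 2)|
  <= 10 * (K + 2) ^+ 3 * s ^+ 3 * expR r.
Proof.
move=> K1 /andP[t0 t2] ts /andP[kap0 kap1] /andP[r0 rK] /andP[y0 yle].
have s0 : 0 <= s by lra.
have st0 : 0 <= s * t by rewrite mulr_ge0 //; lra.
have ksst : kap * s * t <= s * t by rewrite -mulrA ler_piMl.
have ks0 : 0 <= kap * s by rewrite mulr_ge0.
have kst0 : 0 <= kap * s * t by rewrite mulr_ge0 //; lra.
have kss : kap * s <= s by rewrite ler_piMl.
have Ks : r <= K * s by apply: le_trans rK _; rewrite ler_wpM2l //; lra.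
have s3 : 0 <= s ^+ 3 by rewrite exprn_ge0.
(* Since [2 * s >= 1], each lower power of [s] can be traded for [s ^+ 3] at the cost of a
   constant. *)
have s12 : 1 <= 2 * s by lra.
have s2_s3 : s ^+ 2 <= 2 * s ^+ 3.
  have -> : 2 * s ^+ 3 = (2 * s) * s ^+ 2 by ring.
  by rewrite ler_peMl // exprn_ge0.
have s_s3 : s <= 4 * s ^+ 3.
  have -> : 4 * s ^+ 3 = (2 * s) ^+ 2 * s by ring.
  by rewrite ler_peMl // exprn_ege1.
have one_s3 : 1 <= 8 * s ^+ 3.
  have -> : 8 * s ^+ 3 = (2 * s) ^+ 3 by ring.
  by rewrite exprn_ege1.
have st_s2 : s * t <= s ^+ 2 by rewrite expr2 ler_wpM2l.
have e1 : 1 <= expR r by rewrite -[leLHS]expR0 ler_expR.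
set a := r - _ / 2.
have a_le : `|a| <= (K + 1) * s.
  by rewrite ler_norml /a; apply/andP; split; lra.
have a2_le : a ^+ 2 <= (K + 1) ^+ 2 * s ^+ 2.
  by rewrite -exprMn -[a ^+ 2]real_normK ?num_real // ler_pXn2r // nnegrE
    mulr_ge0 //; lra.
have a2_le' : a ^+ 2 <= 2 * (K + 1) ^+ 2 * s ^+ 3.
  apply: le_trans a2_le _; have : 0 <= (K + 1) ^+ 2 by rewrite exprn_ge0 //; lra.
  by move=> /(ler_wpM2l) /(_ _ _ s2_s3); lra.
have a_le' : `|a| <= 4 * (K + 1) * s ^+ 3.
  apply: le_trans a_le _; have : 0 <= K + 1 by lra.
  by move=> /(ler_wpM2l) /(_ _ _ s_s3); lra.
have a20 : 0 <= a ^+ 2 by exact: sqr_ge0.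
(* The first 8 pays for [y]; [13 + 4 * K] pays for the constant 1 (8), for [a] ([4 * (K + 1)]) and
   for the cubic term (1); [(K + 1) ^+ 2] pays for [a ^+ 2 / 2]. *)
have Kp : 0 <= 10 * (K + 2) ^+ 3 - (8 + 13 + 4 * K + (K + 1) ^+ 2).
  have -> : 10 * (K + 2) ^+ 3 - (8 + 13 + 4 * K + (K + 1) ^+ 2) =
    10 * K ^+ 3 + 59 * K ^+ 2 + 114 * K + 58 by ring.
  by rewrite !addr_ge0 ?mulr_ge0 ?exprn_ge0 //; lra.
have s3e : s ^+ 3 <= s ^+ 3 * expR r by rewrite ler_peMr.
have ye : y <= 8 * (s ^+ 3 * expR r).
  by apply: le_trans yle _; rewrite mulrA ler_peMl // ltW ?expR_gt0.
have : 0 <= (10 * (K + 2) ^+ 3 - (8 + 13 + 4 * K + (K + 1) ^+ 2))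
    * (s ^+ 3 * expR r).
  by rewrite !mulr_ge0 // ltW ?expR_gt0.
have : (13 + 4 * K + (K + 1) ^+ 2) * s ^+ 3 <=
    (13 + 4 * K + (K + 1) ^+ 2) * (s ^+ 3 * expR r).
  by rewrite ler_wpM2l // !addr_ge0 ?mulr_ge0 ?exprn_ge0 //; lra.
move: a_le'; rewrite !ler_norml => /andP[? ?] ? ?.
by apply/andP; split; lra.
Qed.

(** * First bounds on the ratio [k / m] *)

Lemma subr1_pow_le_expR (R : realType) (t : R) (k : nat) :
  t <= 1 -> (1 - t) ^+ k <= expR (- (k%:R * t)).
Proof.
move=> t1; rewrite -mulrN expRM_natl lerXn2r ?nnegrE ?expR_ge0 //.
  by rewrite subr_ge0.
exact: expR_ge1Dx.
Qed.

Lemma expR_half_pow (R : realType) (j : nat) :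
  (1 / 2) ^+ j = expR (- (j%:R * ln 2)) :> R.
Proof. by rewrite -mulrN expRM_natl expRN lnK ?posrE // div1r. Qed.

Lemma sum_half_pow (R : realType) (N : nat) :
  \sum_(1 <= j < N.+1) (1 / 2) ^+ j = 1 - (1 / 2) ^+ N :> R.
Proof.
have /= := @sum_quartic_half R 1 0 0 0 0 N; rewrite !mul0r !mulr0 !addr0 mulr1.
move=> <-; apply: eq_bigr => j _.
by rewrite !mul0r !addr0 mulr1.
Qed.

(** If [k / m > ln 2], the [j]-th summand is at most [exp(- j k / m) <= 2^(-j)], and these bounds
    add up to less than 1. *)
Lemma erdos_moser_ratio_ub (R : realType) (m k : nat) :
  (1 < m)%N -> erdos_moser m k -> k%:R / m%:R <= ln 2 :> R.
Proof.
move=> m1 mk; rewrite leNgt; apply/negP => kap.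
have m0 : (0 < m)%N by exact: ltnW.
have m0' : 0 < (m%:R : R) by rewrite ltr0n.
have : 1 <= \sum_(1 <= j < m) (1 / 2) ^+ j :> R.
  rewrite -[leLHS](erdos_moser_normalized R m0 mk).
  apply: ler_sum_nat => j /andP[j1 jm].
  apply: le_trans (subr1_pow_le_expR _ _) _.
    by rewrite ler_pdivrMr // mul1r ler_nat ltnW.
  rewrite expR_half_pow ler_expR lerN2 mulrCA ler_wpM2l ?ler0n //; exact: ltW.
rewrite -(prednK m0) sum_half_pow.
by rewrite leNgt ltrBlDr ltrDl exprn_gt0 //; lra.
Qed.

Lemma ln_subr1_ge (R : realType) (t : R) :
  0 <= t <= 1 / 2 -> - (t + 2 * t ^+ 2) <= ln (1 - t).
Proof.
move=> /[dup] /ln_taylor3/andP[_ H] /andP[t0 t2].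
have t20 : 0 <= t ^+ 2 by exact: sqr_ge0.
have t3 : t ^+ 3 <= 1 / 2 * t ^+ 2 by rewrite exprS ler_wpM2r.
have t4 : t ^+ 4 <= 1 / 2 * t ^+ 3.
  by rewrite (exprS _ 3) ler_wpM2r // exprn_ge0.
lra.
Qed.

Lemma subr1_pow_ge (R : realType) (t : R) (k : nat) :
  0 <= t <= 1 / 2 -> 1 - 2 * (k%:R * t) <= (1 - t) ^+ k.
Proof.
move=> /[dup] /ln_subr1_ge H /andP[t0 t2].
have lnt : - ln (1 - t) <= 2 * t by nra.
have p : 1 - t \is Num.pos by rewrite posrE; lra.
rewrite -[in leRHS](lnK p) -expRM_natl.
apply: le_trans (expR_ge1Dx _); rewrite lerD2l mulrCA -[leRHS]opprK lerN2 -mulrN.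
by rewrite ler_wpM2l.
Qed.

(** The first two summands alone are at least [(1 - 2 k / m) + (1 - 4 k / m)], while the whole sum
    is 1. The bound provides a decay rate, uniform in [m], for all later error series. *)
Lemma erdos_moser_ratio_lb (R : realType) (m k : nat) :
  (3 < m)%N -> erdos_moser m k -> 1 / 6 <= k%:R / m%:R :> R.
Proof.
move=> m3 mk; have m0 : (0 < m)%N by exact: leq_trans m3.
have m0' : 0 < (m%:R : R) by rewrite ltr0n.
have := erdos_moser_normalized R m0 mk.
rewrite big_ltn; last by lia.
rewrite big_ltn; last by lia.
have : 0 <= \sum_(3 <= j < m) (1 - j%:R / m%:R) ^+ k :> R.
  rewrite big_nat; apply: sumr_ge0 => j /andP[_ jm].
  rewrite exprn_ge0 // subr_ge0 ler_pdivrMr // mul1r ler_nat; exact: ltnW.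
have m4 : (4 : R) <= m%:R by rewrite (ler_nat R 4).
have := @subr1_pow_ge R (1 / m%:R) k.
have := @subr1_pow_ge R (2 / m%:R) k.
rewrite !ler_pdivrMr // !divr_ge0 ?ler0n //.
have -> : (2 : R) <= 1 / 2 * m%:R by lra.
have -> : (1 : R) <= 1 / 2 * m%:R by lra.
move=> /(_ isT) + /(_ isT); rewrite !mulrA mulr1 => H1 H2 H3 S1.
have E1 : 2 * k%:R * 2 / m%:R = 4 * (k%:R / m%:R) :> R by field; rewrite gt_eqF.
have E2 : 2 * k%:R / m%:R = 2 * (k%:R / m%:R) :> R by rewrite mulrA.
by rewrite E1 in H1; rewrite E2 in H2; lra.
Qed.

(** Each summand is at least [exp(- kap j) (1 - 4 j^2 / m)], and [exp(- kap j) = 2^(-j) exp(rho j)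
    >= 2^(-j) (1 + rho j)]. Summing to 1 leaves no room for [rho] beyond the [O(1/m)] error. *)
Lemma erdos_moser_defect_bound (R : realType) :
  exists2 K : R, 1 <= K & forall m k : nat, (3 < m)%N -> erdos_moser m k ->
    0 <= ln (2 : R) - k%:R / m%:R <= K / m%:R.
Proof.
have d0 : 0 < (1 / 6 : R) by lra.
have [G G0 HG] := sum_pow_expR_bounded 2 d0.
have d1 : 0 < (2 / 3 : R) by lra.
have [c c0 Hc] := pow_le_expR 1 d1.
exists (1 + 8 * G + 4 * c) => [|m k m3 mk]; first by lra.
have m0 : (0 < m)%N by exact: leq_trans m3.
have m0' : 0 < (m%:R : R) by rewrite ltr0n.
have ub := erdos_moser_ratio_ub R (leq_trans (isT : 1 < 4)%N m3) mk.
have lb := erdos_moser_ratio_lb R m3 mk.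
set kap := k%:R / m%:R in ub lb *.
set rho := ln 2 - kap.
have rho0 : 0 <= rho by rewrite /rho; lra.
rewrite rho0 /=.
have term (j : nat) : (0 < j < m)%N ->
    (1 / 2) ^+ j * (1 + rho * j%:R)
      - 4 / m%:R * (j%:R ^+ 2 * expR (- (1 / 6 * j%:R)))
    <= (1 - j%:R / m%:R) ^+ k.
  move=> /andP[j1 jm].
  set t : R := j%:R / m%:R.
  have t0 : 0 <= t by rewrite divr_ge0.
  have t1 : t <= 1 by rewrite ler_pdivrMr // mul1r ler_nat ltnW.
  have e_le : expR (- (kap * j%:R)) <= expR (- (1 / 6 * j%:R)).
    by rewrite ler_expR lerN2 ler_wpM2r.
  have half_e : (1 / 2) ^+ j * (1 + rho * j%:R) <= expR (- (kap * j%:R)).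
    have -> : - (kap * j%:R) = - (j%:R * ln 2) + rho * j%:R by rewrite /rho; ring.
    by rewrite expRD -expR_half_pow ler_wpM2l ?expR_ge1Dx ?exprn_ge0 //; lra.
  have s_t : 4 / m%:R * j%:R ^+ 2 = 4 * (m%:R * t ^+ 2) :> R.
    by rewrite /t; field; rewrite gt_eqF.
  set e := expR (- (kap * j%:R)) in e_le half_e.
  suff : e * (1 - 4 * (m%:R * t ^+ 2)) <= (1 - t) ^+ k.
    have : 4 * (m%:R * t ^+ 2) * e
        <= 4 * (m%:R * t ^+ 2) * expR (- (1 / 6 * j%:R)).
      by rewrite ler_wpM2l // !mulr_ge0 ?sqr_ge0 // ltW.
    rewrite [4 / m%:R * _]mulrA s_t; lra.
  (* For [t > 1 / 2] the lower bound is nonpositive, because [4 * (m * t ^+ 2) >= 1]. *)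
  have [t2|t2] := leP t (1 / 2); last first.
    apply: (@le_trans _ _ 0); last by rewrite exprn_ge0 //; lra.
    have m1 : 1 <= (m%:R : R) by rewrite ler1n.
    rewrite mulr_ge0_le0 ?expR_ge0 // subr_le0; nra.
  have p : 1 - t \is Num.pos by rewrite posrE; lra.
  have := @ln_subr1_ge R t; rewrite t0 t2 => /(_ isT) lnt.
  rewrite -[in leRHS](lnK p) -expRM_natl.
  have kE : k%:R = kap * m%:R by rewrite /kap mulfVK // gt_eqF.
  have jE : j%:R = t * m%:R by rewrite /t mulfVK // gt_eqF.
  apply: (@le_trans _ _ (expR (- (kap * j%:R) + - (2 * kap * (m%:R * t ^+ 2))))).
    rewrite expRD ler_wpM2l ?expR_ge0 //.
    apply: le_trans (expR_ge1Dx _); rewrite lerD2l lerN2.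
    apply: ler_wpM2r; first by rewrite mulr_ge0 ?sqr_ge0.
    have /andP[_] := ln2_bounds R; rewrite /rho in rho0 *; lra.
  have := ler_wpM2l (ler0n R k) lnt.
  rewrite ler_expR kE jE; lra.
have := erdos_moser_normalized R m0 mk; rewrite big_nat => S1.
have := ler_sum_nat term; rewrite [leRHS]big_nat S1.
rewrite sumrB -mulr_sumr.
have n0 : 0 < 4 / m%:R :> R by rewrite divr_gt0.
have := ler_wpM2l (ltW n0) (HG m).
(* Of the terms linear in [rho] only [j = 1], worth [rho / 2], is kept. *)
have : 1 - (1 / 2) ^+ m.-1 + rho / 2 <=
    \sum_(1 <= j < m) (1 / 2) ^+ j * (1 + rho * j%:R).
  under eq_bigr do rewrite mulrDr mulr1.
  rewrite big_split /= -[in X in \sum_(_ <= _ < X) _ ^+ _](prednK m0) sum_half_pow.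
  rewrite lerD2l big_ltn; last by lia.
  rewrite expr1 mulr1 -[leLHS]addr0 mulrC div1r lerD2l.
  by apply: sumr_ge0 => j _; rewrite !mulr_ge0 ?exprn_ge0 //; lra.
have : (1 / 2) ^+ m.-1 <= 2 * c / m%:R.
  have -> : (1 / 2) ^+ m.-1 = 2 * (1 / 2) ^+ m :> R.
    by rewrite -[in RHS](prednK m0) exprS; field.
  rewrite -mulrA ler_wpM2l // ler_pdivlMr // expR_half_pow.
  rewrite -ler_pdivlMl ?expR_gt0 // expRN invrK mulrC.
  apply: le_trans (Hc _ (ler0n _ _)) _; rewrite ler_wpM2l ?(ltW c0) // ler_expR.
  rewrite mulrC ler_wpM2l //; have /andP[] := ln2_bounds R; lra.
move=> H1 H2 H3 H4; rewrite ler_pdivlMr //.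
have H5 : rho / 2 <= 2 * c / m%:R + 4 / m%:R * G by lra.
have := ler_wpM2r (ltW m0') H5.
have -> : (2 * c / m%:R + 4 / m%:R * G) * m%:R = 2 * c + 4 * G.
  by field; rewrite gt_eqF.
lra.
Qed.

(** * Third-order expansion of the equation *)

(** The quartic in [j] is the approximation of the perturbation bounds, regrouped by powers of [j].
    The error factor arises from [s ^+ 3 = j^6 n^3] and [2^(-j) exp(r) = exp(- kap j)]. *)
Lemma erdos_moser_term_expansion (R : realType) (K : R) (m k j : nat) :
  let n := m%:R^-1 in let kap := k%:R / m%:R in let rho := ln (2 : R) - kap in
  1 <= K -> (0 < j < m)%N -> kap <= 1 -> 0 <= rho <= K / m%:R ->
  `|(1 - j%:R / m%:R) ^+ k - (1 / 2) ^+ j *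
     (1 + rho * j%:R + (rho ^+ 2 - kap * n) / 2 * j%:R ^+ 2
      + (- (kap * n ^+ 2 / 3) - rho * kap * n / 2) * j%:R ^+ 3
      + kap ^+ 2 * n ^+ 2 / 8 * j%:R ^+ 4)|
  <= 10 * (K + 2) ^+ 3 * n ^+ 3 * (j%:R ^+ 6 * expR (- (kap * j%:R))).
Proof.
move=> n kap rho K1 /andP[j0 jm] kap1 /andP[rho0 rhoK].
have m0 : (0 < m)%N by exact: leq_ltn_trans jm.
have m0' : 0 < (m%:R : R) by rewrite ltr0n.
have n0 : 0 < n by rewrite invr_gt0.
have kap0 : 0 <= kap by rewrite divr_ge0.
set x : R := j%:R.
have x1 : 1 <= x by rewrite ler1n.
pose t := x * n; pose s := x ^+ 2 * n; pose r := rho * x.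
have t0 : 0 <= t by rewrite mulr_ge0 ?ltW //; lra.
have t1 : t <= 1 by rewrite /t ler_pdivrMr // mul1r ler_nat ltnW.
have ts : t <= s by rewrite /t /s expr2 -mulrA ler_peMl.
have r_bd : 0 <= r <= K * t.
  apply/andP; split; first by rewrite mulr_ge0 //; lra.
  by rewrite /r /t mulrCA mulrC ler_wpM2l //; lra.
have kap01 : 0 <= kap <= 1 by rewrite kap0.
have h0 : 0 < (1 / 2 : R) ^+ j by rewrite exprn_gt0 //; lra.
have EK : 10 * (K + 2) ^+ 3 * n ^+ 3 * (x ^+ 6 * expR (- (kap * x))) =
    (1 / 2) ^+ j * (10 * (K + 2) ^+ 3 * s ^+ 3 * expR r).
  have -> : - (kap * x) = - (x * ln 2) + r by rewrite /r /rho; ring.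
  by rewrite expRD -expR_half_pow /s; ring.
have EQ : 1 + rho * x + (rho ^+ 2 - kap * n) / 2 * x ^+ 2
      + (- (kap * n ^+ 2 / 3) - rho * kap * n / 2) * x ^+ 3
      + kap ^+ 2 * n ^+ 2 / 8 * x ^+ 4 =
    1 + (r - kap * s / 2) - kap * s * t / 3 + (r - kap * s / 2) ^+ 2 / 2.
  by rewrite /r /s /t; field.
rewrite EK EQ.
(* [y] is the summand rescaled by [2^j], hence close to 1 for small [t]. *)
pose y := expR (x * ln 2) * (1 - x / m%:R) ^+ k.
have hy : (1 / 2) ^+ j * expR (x * ln 2) = 1.
  by rewrite expR_half_pow -expRD addNr expR0.
have -> : (1 - x / m%:R) ^+ k = (1 / 2) ^+ j * y by rewrite /y mulrA hy mul1r.
rewrite -mulrBr normrM gtr0_norm //; apply: ler_wpM2l; first exact: ltW.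
have kE : k%:R = kap * m%:R by rewrite /kap mulfVK // gt_eqF.
have [t2|t2] := leP t (1 / 2); last first.
  apply: (expR_perturbation_far K1 _ ts kap01 r_bd); first by rewrite (ltW t2).
  apply/andP; split.
    by rewrite mulr_ge0 ?expR_ge0 // exprn_ge0 // subr_ge0.
  have := subr1_pow_le_expR k t1.
  move=> /(ler_wpM2l (expR_ge0 (x * ln 2))); rewrite -expRD => /le_trans; apply.
  rewrite ler_expR kE /t /r /rho.
  have -> : kap * m%:R * (x * n) = kap * x by rewrite /n; field; rewrite gt_eqF.
  by rewrite mulrBl mulrC.
have p : 1 - t \is Num.pos by rewrite posrE; lra.
pose w := k%:R * (- ln (1 - t) - (t + t ^+ 2 / 2 + t ^+ 3 / 3)).
have mt : m%:R * t = x by rewrite /t /n; field; rewrite gt_eqF.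
have mt2 : m%:R * t ^+ 2 = s by rewrite /s /t /n; field; rewrite gt_eqF.
have -> : y = expR (r - kap * s / 2 - kap * s * t / 3 - w).
  rewrite /y -/(x * n) -/t -[in LHS](lnK p) -expRM_natl -expRD; congr expR.
  by rewrite /w kE -mt2 /r /rho -mt; field.
apply: expR_perturbation => //; first by rewrite t0.
have := @ln_taylor3 R t; rewrite t0 t2 => /(_ isT)/andP[w0 w1].
rewrite /w mulr_ge0 //=.
apply: le_trans (ler_wpM2l (ler0n _ _) w1) _.
rewrite kE -mt2.
have -> : kap * m%:R * (2 * t ^+ 4) = kap * (2 * (m%:R * t ^+ 2) * t ^+ 2) by ring.
have mt20 : 0 <= m%:R * t ^+ 2 by rewrite mulr_ge0 ?sqr_ge0 ?ltW.
by rewrite ler_piMl // mulr_ge0 ?sqr_ge0 // mulr_ge0 // ltW.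
Qed.

Lemma half_pow_le (R : realType) (a : nat) :
  exists2 c : R, 0 < c & forall N, N%:R ^+ a * (1 / 2) ^+ N <= c.
Proof.
have d0 : 0 < (2 / 3 : R) by lra.
have [c c0 Hc] := pow_le_expR a d0.
exists c => // N.
rewrite expR_half_pow expRN ler_pdivrMr ?expR_gt0 //.
apply: le_trans (Hc _ (ler0n _ _)) _; rewrite ler_wpM2l ?(ltW c0) // ler_expR.
by rewrite mulrC ler_wpM2l //; have /andP[] := ln2_bounds R; lra.
Qed.

(** The constant 300 covers [1 + 8 + 36 + 104 + 150 = 299], the largest coefficient sum among these
    polynomials. *)
Lemma quartic_le (R : realType) (c0 c1 c2 c3 c4 x B : R) :
  1 <= x -> `|c0| + `|c1| + `|c2| + `|c3| + `|c4| <= B ->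
  `|c0 + c1 * (x + 2) + c2 * (x ^+ 2 + 4 * x + 6)
    + c3 * (x ^+ 3 + 6 * x ^+ 2 + 18 * x + 26)
    + c4 * (x ^+ 4 + 8 * x ^+ 3 + 36 * x ^+ 2 + 104 * x + 150)|
  <= 300 * B * x ^+ 4.
Proof.
move=> x1 cB.
have x2 : x <= x ^+ 2 by rewrite expr2 ler_peMl //; lra.
have x3 : x ^+ 2 <= x ^+ 3 by rewrite (exprS x 2) ler_peMl // exprn_ge0 //; lra.
have x4 : x ^+ 3 <= x ^+ 4 by rewrite (exprS x 3) ler_peMl // exprn_ge0 //; lra.
have [M ME] : exists M, M = 300 * x ^+ 4 by exists (300 * x ^+ 4).
have mono (c p : R) : 0 <= p -> p <= M -> `|c * p| <= `|c| * M.
  by move=> p0 pu; rewrite normrM (ger0_norm p0) ler_wpM2l.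
have x40 : 0 <= M by lra.
have -> : 300 * B * x ^+ 4 = B * M by rewrite ME; ring.
apply: le_trans (ler_wpM2r x40 cB).
rewrite 4![in leRHS]mulrDl.
do 4![apply: le_trans (ler_normD _ _) _; apply: lerD; last by apply: mono; lra].
by rewrite -[in leLHS](mulr1 c0); apply: mono; lra.
Qed.

(** Summing the term expansions gives the moments 2, 6, 26, 150 as weights, and the constant moment
    1 cancels the right-hand side of the equation. Writing [kap] as [ln 2 - rho] leaves a relation
    between [rho] and [n] alone. *)
Lemma erdos_moser_expansion (R : realType) :
  exists K C : R, [/\ 1 <= K, 0 < C & forall m k : nat, (3 < m)%N ->
    erdos_moser m k ->
    let n := m%:R^-1 in let rho := ln (2 : R) - k%:R / m%:R in
    let kap := ln 2 - rho in
    0 <= rho <= K * n /\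
    `|2 * rho + 3 * (rho ^+ 2 - kap * n)
      + 26 * (- (kap * n ^+ 2 / 3) - rho * kap * n / 2)
      + 150 * (kap ^+ 2 * n ^+ 2 / 8)| <= C * n ^+ 3].
Proof.
have [K K1 HK] := erdos_moser_defect_bound R.
have d0 : 0 < (1 / 6 : R) by lra.
have [G G0 HG] := sum_pow_expR_bounded 6 d0.
(* 7 = 4 + 3: degree 4 of the tail polynomial, and [N ^+ 3] to reach an error of order [n ^+ 3]. *)
have [c c0 Hc] := half_pow_le R 7.
pose D := 10 * (K + 2) ^+ 3.
have D0 : 0 <= D by rewrite mulr_ge0 // exprn_ge0 //; lra.
pose B := 1 + K + (K ^+ 2 + 1) + (1 + K) + 1.
have B0 : 0 < B by rewrite /B; nra.
exists K, (D * G + 8 * (300 * B * c)); split; first exact: K1.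
  have DG0 : 0 <= D * G by rewrite mulr_ge0 // ltW.
  have Bc0 : 0 < B * c by exact: mulr_gt0.
  lra.
move=> m k m3 mk n rho kap.
have /andP[rho0 rhoK] := HK _ _ m3 mk.
have kapE : kap = k%:R / m%:R by rewrite /kap /rho; ring.
rewrite -/rho in rho0 rhoK.
split; first by rewrite rho0.
have m0 : (0 < m)%N by exact: leq_trans m3.
have m0' : 0 < (m%:R : R) by rewrite ltr0n.
have n0 : 0 < n by rewrite invr_gt0.
have n1 : n <= 1 by rewrite /n invf_le1 // ler1n.
have m_n : m%:R = n^-1 by rewrite /n invrK.
have ub := erdos_moser_ratio_ub R (leq_trans (isT : 1 < 4)%N m3) mk.
have lb := erdos_moser_ratio_lb R m3 mk.
have kap1 : k%:R / m%:R <= 1 :> R by have /andP[_] := ln2_bounds R; lra.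
have rho_bd : 0 <= ln (2 : R) - k%:R / m%:R <= K / m%:R by rewrite -/rho rho0.
pose q (j : nat) : R := (1 / 2) ^+ j *
     (1 + rho * j%:R + (rho ^+ 2 - kap * n) / 2 * j%:R ^+ 2
      + (- (kap * n ^+ 2 / 3) - rho * kap * n / 2) * j%:R ^+ 3
      + kap ^+ 2 * n ^+ 2 / 8 * j%:R ^+ 4).
have sum_err : `|1 - \sum_(1 <= j < m) q j| <= D * G * n ^+ 3.
  rewrite -(erdos_moser_normalized R m0 mk) -sumrB.
  apply: le_trans (ler_norm_sum _ _ _) _.
  apply: (@le_trans _ _ (D * n ^+ 3 *
      \sum_(1 <= j < m) j%:R ^+ 6 * expR (- (1 / 6 * j%:R)))); last first.
    rewrite [leRHS]mulrAC; apply: ler_wpM2l; last exact: HG.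
    by rewrite mulr_ge0 // exprn_ge0 // ltW.
  rewrite mulr_sumr; apply: ler_sum_nat => j jm.
  have := erdos_moser_term_expansion K1 jm kap1 rho_bd.
  rewrite /q kapE => /le_trans; apply.
  have n30 : 0 <= n ^+ 3 by rewrite exprn_ge0 // ltW.
  apply: ler_wpM2l; first exact: mulr_ge0.
  apply: ler_wpM2l; first exact: exprn_ge0.
  by rewrite ler_expR lerN2 ler_wpM2r.
have [N mN N0] : exists2 N, m = N.+1 & (0 < N)%N.
  exists m.-1; first by rewrite prednK.
  by rewrite ltn_predRL; exact: leq_trans m3.
have N1 : 1 <= (N%:R : R) by rewrite ler1n.
have sumE := sum_quartic_half 1 rho ((rho ^+ 2 - kap * n) / 2)
  (- (kap * n ^+ 2 / 3) - rho * kap * n / 2) (kap ^+ 2 * n ^+ 2 / 8) N.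
set tail := _ ^+ N * _ in sumE.
have tail_le : `|tail| <= 8 * (300 * B * c) * n ^+ 3.
  have kap01 : 0 <= kap <= 1 by rewrite kapE; lra.
  have /andP[kap0 kap1'] := kap01.
  have kap_n : kap * n <= 1 by apply: mulr_ile1 => //; exact: ltW.
  have rhoK' : rho <= K.
    by apply: le_trans rhoK _; rewrite ler_pdivrMr // ler_peMr ?ler1n //; lra.
  have n2 : n ^+ 2 <= 1 by rewrite exprn_ile1 // ltW.
  have n20 : 0 <= n ^+ 2 by rewrite exprn_ge0 // ltW.
  have kn0 : 0 <= kap * n by rewrite mulr_ge0 // ltW.
  have kn20 : 0 <= kap * n ^+ 2 by rewrite mulr_ge0.
  have kn2 : kap * n ^+ 2 <= 1 by rewrite mulr_ile1.
  have rkn : rho * kap * n <= K by rewrite -mulrA -[leRHS]mulr1 ler_pM.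
  have rkn0 : 0 <= rho * kap * n by rewrite -mulrA mulr_ge0.
  have k2n2 : kap ^+ 2 * n ^+ 2 <= 1 by rewrite -exprMn exprn_ile1.
  have k2n20 : 0 <= kap ^+ 2 * n ^+ 2 by rewrite -exprMn exprn_ge0.
  have rho2 : rho ^+ 2 <= K ^+ 2 by rewrite ler_pXn2r // nnegrE; lra.
  have rho20 : 0 <= rho ^+ 2 by exact: sqr_ge0.
  have h0 : 0 <= (1 / 2 : R) ^+ N by rewrite exprn_ge0 //; lra.
  rewrite /tail normrM (ger0_norm h0).
  set c2 := (rho ^+ 2 - kap * n) / 2; set c3 := - (_ / 3) - _; set c4 := _ / 8.
  have coeffs : `|1| + `|rho| + `|c2| + `|c3| + `|c4| <= B.
    rewrite normr1 (ger0_norm rho0) /B; apply: lerD; last first.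
      by rewrite ler_norml /c4; apply/andP; split; lra.
    apply: lerD; last by rewrite ler_norml /c3; apply/andP; split; lra.
    apply: lerD; last by rewrite ler_norml /c2; apply/andP; split; lra.
    by rewrite lerD2l.
  apply: le_trans (ler_wpM2l h0 (quartic_le N1 coeffs)) _.
  have N3 : 0 < (N%:R : R) ^+ 3 by rewrite exprn_gt0 //; lra.
  rewrite -(ler_pM2r N3).
  have -> : (1 / 2) ^+ N * (300 * B * N%:R ^+ 4) * N%:R ^+ 3 =
      300 * B * (N%:R ^+ 7 * (1 / 2) ^+ N) :> R by ring.
  apply: (@le_trans _ _ (300 * B * c)); first by rewrite ler_wpM2l //; lra.
  (* The factor 8 is the cube of 2 in [2 * n * N >= 1], which holds as [N = m - 1 >= m / 2]. *)
  have -> : 8 * (300 * B * c) * n ^+ 3 * N%:R ^+ 3 =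
      300 * B * c * (2 * n * N%:R) ^+ 3 by ring.
  have Bc0 : 0 < B * c by exact: mulr_gt0.
  rewrite ler_peMr //; first by lra.
  rewrite exprn_ege1 //.
  rewrite mulrAC ler_pdivlMr // mul1r mN -natr1; lra.
have -> : 2 * rho + 3 * (rho ^+ 2 - kap * n)
      + 26 * (- (kap * n ^+ 2 / 3) - rho * kap * n / 2)
      + 150 * (kap ^+ 2 * n ^+ 2 / 8) = tail - (1 - \sum_(1 <= j < m) q j).
  by rewrite mN sumE; field.
rewrite mulrDl [leRHS]addrC.
by apply: le_trans (ler_normB _ _) _; rewrite lerD.
Qed.

(** * Solving for [rho] and for [k] *)

(** A two-step bootstrap: the relation first gives [rho] up to [O(n^2)], and substituting this into
    it gives the next term. For [2 rho] the [n^2] coefficient is [(26/3 - 9/2) al + (- 27/4 + 39/2 -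
    75/4) al^2 = 25/6 al - 6 al^2]. *)
Lemma defect_second_order (R : realType) (al K C : R) :
  2 / 3 <= al <= 1 -> 1 <= K -> 0 < C ->
  exists2 C' : R, 0 < C' & forall n rho : R, let kap := al - rho in
    0 < n <= 1 -> 0 <= rho <= K * n -> 0 <= kap ->
    `|2 * rho + 3 * (rho ^+ 2 - kap * n)
      + 26 * (- (kap * n ^+ 2 / 3) - rho * kap * n / 2)
      + 150 * (kap ^+ 2 * n ^+ 2 / 8)| <= C * n ^+ 3 ->
    `|rho - 3 / 2 * al * n - al * (25 / 12 - 3 * al) * n ^+ 2| <= C' * n ^+ 3.
Proof.
move=> /andP[al0 al1] K1 C0.
pose C2 := C + 3 * K ^+ 2 + 16 * K + 28.
have K20 : 0 <= K ^+ 2 by exact: sqr_ge0.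
have C20 : 0 < C2 by rewrite /C2; lra.
pose C3 := C + 3 * (C2 * (K + 2)) + 16 * C2 + 13 * K ^+ 2 + 47 * K.
exists C3; first by rewrite /C3 !addr_gt0 ?mulr_gt0 //; nra.
move=> n rho kap /andP[n0 n1] /andP[rho0 rhoK] kap0.
have kap1 : kap <= 1 by rewrite /kap; lra.
set F := (X in `|X| <= _) => HF.
have n20 : 0 <= n ^+ 2 by rewrite exprn_ge0 // ltW.
have n30 : 0 <= n ^+ 3 by rewrite exprn_ge0 // ltW.
have n0' := ltW n0.
have rho2 : rho ^+ 2 <= K ^+ 2 * n ^+ 2.
  by rewrite -exprMn lerXn2r // nnegrE mulr_ge0 //; lra.
have rho20 : 0 <= rho ^+ 2 by exact: sqr_ge0.
have rn0 : 0 <= rho * n by rewrite mulr_ge0.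
have rn : rho * n <= K * n ^+ 2 by rewrite expr2 mulrA ler_wpM2r.
have kn20 : 0 <= kap * n ^+ 2 by rewrite mulr_ge0.
have kn2 : kap * n ^+ 2 <= n ^+ 2 by rewrite ler_piMl.
have k1 : kap ^+ 2 <= 1 by rewrite exprn_ile1.
have k2n20 : 0 <= kap ^+ 2 * n ^+ 2 by rewrite mulr_ge0 ?sqr_ge0.
have k2n2 : kap ^+ 2 * n ^+ 2 <= n ^+ 2 by rewrite ler_piMl.
have krn0 : 0 <= kap * (rho * n) by rewrite mulr_ge0.
have krn : kap * (rho * n) <= rho * n by rewrite ler_piMl.
have n32 : C * n ^+ 3 <= C * n ^+ 2.
  by rewrite ler_wpM2l ?(ltW C0) // (exprS n 2) ler_piMl.
pose d := rho - 3 / 2 * al * n.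
have d_le : `|d| <= C2 * n ^+ 2.
  (* The first-order part of the hypothesis, [2 rho - 3 al n = O(n^2)]. *)
  have E2 : 2 * d = F - 3 * rho ^+ 2 - 3 * (rho * n) + 26 / 3 * (kap * n ^+ 2)
      + 13 * (kap * (rho * n)) - 75 / 4 * (kap ^+ 2 * n ^+ 2).
    by rewrite /d /F /kap; field.
  move: HF; rewrite !ler_norml /C2 => /andP[? ?].
  by apply/andP; split; lra.
have dn_le (y Y : R) : `|y| <= Y * n -> `|d * y| <= C2 * Y * n ^+ 3.
  move=> yY; rewrite normrM.
  have -> : C2 * Y * n ^+ 3 = C2 * n ^+ 2 * (Y * n) by ring.
  exact: ler_pM.
have t1 : `|d * (rho + 3 / 2 * al * n)| <= C2 * (K + 2) * n ^+ 3.
  have aln : al * n <= n by rewrite ler_piMl.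
  have aln0 : 0 <= al * n by rewrite mulr_ge0 //; lra.
  by apply: dn_le; rewrite ger0_norm; lra.
have t2 : `|d * n| <= C2 * 1 * n ^+ 3 by apply: dn_le; rewrite mul1r ger0_norm.
have t3 : `|d * (al * n)| <= C2 * 1 * n ^+ 3.
  by apply: dn_le; rewrite mul1r ger0_norm ?ler_piMl // mulr_ge0 //; lra.
have t4 : n * rho ^+ 2 <= K ^+ 2 * n ^+ 3.
  have -> : K ^+ 2 * n ^+ 3 = n * (K ^+ 2 * n ^+ 2) by ring.
  exact: ler_wpM2l.
have t40 : 0 <= n * rho ^+ 2 by rewrite mulr_ge0.
have t50 : 0 <= n ^+ 2 * rho by rewrite mulr_ge0.
have t5 : n ^+ 2 * rho <= K * n ^+ 3.
  have -> : K * n ^+ 3 = n ^+ 2 * (K * n) by ring.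
  exact: ler_wpM2l.
have t60 : 0 <= n ^+ 2 * rho * (kap + al) by rewrite mulr_ge0 // addr_ge0 //; lra.
have t6 : n ^+ 2 * rho * (kap + al) <= 2 * (n ^+ 2 * rho).
  by rewrite mulrC; apply: ler_wpM2r => //; lra.
(* Substituting [rho = 3/2 al n + O(n^2)] into the quadratic terms. *)
have E3 : 2 * (rho - 3 / 2 * al * n - al * (25 / 12 - 3 * al) * n ^+ 2) =
    F - 3 * (d * (rho + 3 / 2 * al * n)) - 3 * (d * n) + 13 * (d * (al * n))
    - 13 * (n * rho ^+ 2) - 26 / 3 * (n ^+ 2 * rho)
    + 75 / 4 * (n ^+ 2 * rho * (kap + al)).
  by rewrite /d /F /kap; field.
have K2n : 0 <= K ^+ 2 * n ^+ 3 by rewrite mulr_ge0.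
have Kn : 0 <= K * n ^+ 3 by lra.
have C2n : 0 <= C2 * n ^+ 3 by rewrite mulr_ge0 // ltW.
have C2Kn : 0 <= C2 * (K + 2) * n ^+ 3 by rewrite !mulr_ge0 // ?(ltW C20) //; lra.
move: HF t1 t2 t3; rewrite !ler_norml => /andP[? ?] /andP[? ?] /andP[? ?] /andP[? ?].
by rewrite /C3; apply/andP; split; lra.
Qed.

(** As [k = m (ln 2 - rho)], this is the second-order formula for [rho] multiplied by [m]. *)
Lemma erdos_moser_asymptotics (R : realType) :
  exists2 C : R, 0 < C & forall m k : nat, (3 < m)%N -> erdos_moser m k ->
    `|k%:R - (ln 2 * (m%:R - 3 / 2) - ln 2 * (25 / 12 - 3 * ln 2) / m%:R)|
    <= C / m%:R ^+ 2.
Proof.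
have [K [C [K1 C0 H]]] := erdos_moser_expansion R.
have al_bd : 2 / 3 <= ln (2 : R) <= 1.
  by have /andP[-> /=] := ln2_bounds R; lra.
have [C' C'0 H'] := defect_second_order al_bd K1 C0.
exists C' => // m k m3 mk.
pose n : R := m%:R^-1; pose rho : R := ln (2 : R) - k%:R / m%:R.
have [rho_bd HF] := H _ _ m3 mk; rewrite -/n -/rho in rho_bd HF.
have m0' : 0 < (m%:R : R) by rewrite ltr0n; exact: leq_trans m3.
have n01 : 0 < n <= 1 by rewrite invr_gt0 m0' invf_le1 // ler1n -(ltr0n R).
have kap0 : 0 <= ln 2 - rho.
  have -> : ln 2 - rho = k%:R / m%:R by rewrite /rho; ring.
  exact: divr_ge0.
have := H' n rho n01 rho_bd kap0 HF.
move=> /(ler_wpM2l (ltW m0')); rewrite -[X in X * `|_|]gtr0_norm // -normrM -normrN.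
congr (`|_| <= _); rewrite /rho /n; field; by rewrite gt_eqF.
Qed.

(** * Spacing of solutions within a factor of two *)

Lemma lattice_points_gap (R : realType) (al sig C : R) :
  0 < sig <= 1 / 12 -> 0 < C -> exists M B : nat, forall m m' k k' : nat,
    (M <= m)%N -> (m <= m' <= 2 * m)%N ->
    `|k%:R - (al * (m%:R - 3 / 2) - sig / m%:R)| <= C / m%:R ^+ 2 ->
    `|k'%:R - (al * (m'%:R - 3 / 2) - sig / m'%:R)| <= C / m'%:R ^+ 2 ->
    (m' <= m + B)%N.
Proof.
move=> /andP[sig0 sig1] C0.
(* The first witness gives [m >= 2] and [m > 24 * C], so that the error [12 * C / m] in [D] is below
   [1 / 2]; the second exceeds the final bound [3 * C / sig] on [m' - m]. *)
exists (Num.truncn (24 * C)).+2, (Num.truncn (3 * C / sig)).+1.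
move=> m m' k k' Mm /andP[mm' m'm].
have m2 : (2 <= m)%N by exact: leq_trans Mm.
set x : R := m%:R; set x' : R := m'%:R; set y : R := k%:R; set y' : R := k'%:R.
have x2 : 2 <= x by rewrite (ler_nat R 2).
have xC : 24 * C < x.
  apply: lt_le_trans (truncnS_gt _) _; rewrite ler_nat; exact: ltnW.
have xx' : x <= x' by rewrite ler_nat.
have x'x : x' <= 2 * x by rewrite -natrM ler_nat.
have x0 : 0 < x by lra.
have x'0 : 0 < x' by lra.
pose n := x^-1; pose n' := x'^-1.
have n0 : 0 < n by rewrite invr_gt0.
have n'0 : 0 < n' by rewrite invr_gt0.
have n'n : n' <= n by rewrite lef_pV2.
have xn : x * n = 1 by rewrite divff // gt_eqF.
have xn' : x' * n' = 1 by rewrite divff // gt_eqF.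
have Cn : 24 * (C * n) < 1 by rewrite mulrA ltr_pdivrMr // mul1r.
rewrite -!exprVn -/n -/n'.
set e := y - _; set e' := y' - _ => He He'.
pose a := 2 * x - 3; pose a' := 2 * x' - 3.
pose S := a' * n - a * n'.
(* The leading parts [al * a / 2] of [y] and [al * a' / 2] of [y'] cancel in [D], whatever [al]
   is. *)
pose D := 2 * y * a' - 2 * y' * a.
have DE : D = - (2 * sig * S) + 2 * (e * a') - 2 * (e' * a).
  by rewrite /D /S /e /e' -/n -/n' /a /a'; field.
have a0 : 0 <= a by rewrite /a; lra.
have S_lb : 2 * ((x' - x) * n) <= S.
  have : a * n' <= a * n by exact: ler_wpM2l.
  by rewrite /S /a /a'; lra.
have S0 : 0 <= S.
  by apply: le_trans S_lb; rewrite !mulr_ge0 // ?subr_ge0 // ltW.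
(* From [m' <= 2 m]: [2 x' n <= 4], [2 x n' >= 1] and [n' <= n]. With [sig <= 1 / 12] the main term
   of [D] is then at most [1 / 2] in absolute value. *)
have S3 : S <= 3.
  have h1 : x' * n <= 2 by rewrite ler_pdivrMr.
  have h2 : 1 <= 2 * (x * n') by rewrite mulrA ler_pdivlMr // mul1r.
  by rewrite /S /a /a'; lra.
have ea : `|e * a'| <= 4 * (C * n).
  rewrite normrM (@ger0_norm _ a'); last by rewrite /a'; lra.
  apply: (@le_trans _ _ (C * n ^+ 2 * (4 * x))).
    by apply: ler_pM => //; rewrite /a'; lra.
  have -> : C * n ^+ 2 * (4 * x) = 4 * (C * n) * (x * n) by ring.
  by rewrite xn mulr1.
have ea' : `|e' * a| <= 2 * (C * n).
  rewrite normrM (@ger0_norm _ a) //.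
  apply: (@le_trans _ _ (C * n' ^+ 2 * (2 * x'))).
    by apply: ler_pM => //; rewrite /a; lra.
  have -> : C * n' ^+ 2 * (2 * x') = 2 * (C * n') * (x' * n') by ring.
  by rewrite xn' mulr1 ler_wpM2l // ler_wpM2l // ltW.
have sS0 : 0 <= sig * S by rewrite mulr_ge0 // ltW.
have sS : sig * S <= 1 / 12 * 3 by apply: ler_pM => //; exact: ltW.
have D0 : D = 0.
  pose z : int := 2 * k%:Z * (2 * m'%:Z - 3) - 2 * k'%:Z * (2 * m%:Z - 3).
  have Dz : D = z%:~R by rewrite /D /z /a /a' !(rmorphB, rmorphM) /=.
  have : `|D| < 1.
    move: ea ea'; rewrite DE ltr_norml !ler_norml => /andP[? ?] /andP[? ?].
    by apply/andP; split; lra.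
  rewrite Dz -intr_norm -[1]/(1%:~R) ltr_int => z1.
  suff /eqP-> : z == 0 by [].
  by rewrite -normr_le0 -ltzD1 add0r.
have sS_le : 2 * (sig * S) <= 12 * (C * n).
  move: ea ea'; rewrite !ler_norml => /andP[? ?] /andP[? ?]; lra.
have gap : sig * (x' - x) <= 3 * C.
  have := ler_wpM2l (ltW sig0) S_lb => h.
  by rewrite -(ler_pM2r n0); lra.
have : x' - x < (Num.truncn (3 * C / sig)).+1%:R.
  by apply: le_lt_trans (truncnS_gt _); rewrite ler_pdivlMr // mulrC.
by rewrite ltrBlDl -natrD ltr_nat; exact: ltnW.
Qed.

(** * Counting over dyadic blocks *)

(** [M] bounds the values below [M], 1 accounts for the initial range [iota 0 1], and each of the
    [I] dyadic blocks contributes at most [2 * B + 1]. *)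
Lemma count_dyadic (P : pred nat) (M B : nat) :
  (forall m m', (M <= m)%N -> (m <= m' <= 2 * m)%N -> P m -> P m' ->
    (m' <= m + B)%N) ->
  forall I, (count P (iota 0 (2 ^ I)) <= M + 1 + I * (2 * B + 1))%N.
Proof.
move=> gap I.
pose Q := [pred m | P m & (M <= m)%N].
have small n : (count [pred m | (m < M)%N] (iota 0 n) <= M)%N.
  rewrite -size_filter -[leqRHS](size_iota 0).
  apply: uniq_leq_size; first by rewrite filter_uniq // iota_uniq.
  by move=> m; rewrite mem_filter !mem_iota add0n => /andP[].
have : (count Q (iota 0 (2 ^ I)) <= 1 + I * (2 * B + 1))%N.
  elim: I => [|I IHI].
    by apply: leq_trans (count_size _ _) _; rewrite size_iota.
  rewrite expnS mul2n -addnn iotaD count_cat add0n.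
  suff : (count Q (iota (2 ^ I) (2 ^ I)) <= 2 * B + 1)%N by lia.
  rewrite -size_filter.
  set l := seq.filter Q _.
  have lP m : m \in l -> [/\ P m, (M <= m)%N, (2 ^ I <= m)%N & (m < 2 * 2 ^ I)%N].
    rewrite mem_filter mem_iota /= => /andP[/andP[? ?] /andP[? ?]]; split=> //.
    by rewrite mul2n -addnn.
  have lU : uniq l by rewrite filter_uniq // iota_uniq.
  case: l lP lU => // a l lP lU.
  (* All counted values of the block lie within [B] of its member [a]; truncation of [a - B] at 0
     only moves the window up, and it still contains [a + B]. *)
  rewrite -[leqRHS](size_iota (a - B)).
  apply: uniq_leq_size => // b bl.
  have [Pa Ma a1 a2] := lP a (mem_head _ _).
  have [Pb Mb b1 b2] := lP b bl.
  rewrite mem_iota.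
  have [ab|ba] := leqP a b.
    have : (b <= a + B)%N by apply: gap => //; lia.
    lia.
  have : (a <= b + B)%N by apply: gap => //; lia.
  lia.
suff : (count P (iota 0 (2 ^ I)) <=
    count [pred m | (m < M)%N] (iota 0 (2 ^ I)) + count Q (iota 0 (2 ^ I)))%N.
  by have := small (2 ^ I)%N; lia.
rewrite -count_predUI; apply: leq_trans (leq_addr _ _).
by apply: sub_count => m /= Pm; rewrite Pm /=; case: ltnP.
Qed.

(** * The logarithmic bound *)

Theorem corollary2 (R : realType) :
  (fun x : R => (moser_count x)%:R : R) =O_ (+oo_ R) (fun x : R => ln x).
Proof.
have [C C0 asym] := erdos_moser_asymptotics R.
have /andP[ln2_lb ln2_ub] := ln2_bounds R.
have sig_bd : 0 < ln (2 : R) * (25 / 12 - 3 * ln 2) <= 1 / 12.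
  by apply/andP; split; nra.
have [M [B gap]] := lattice_points_gap (ln 2) sig_bd C0.
pose P : pred nat := fun m => `[< exists k, erdos_moser m k >].
have cnt := @count_dyadic P (maxn M 4) B.
have {}cnt I : (count P (iota 0 (2 ^ I)) <= maxn M 4 + 1 + I * (2 * B + 1))%N.
  apply: cnt => m m'; rewrite geq_max => /andP[Mm m4] mm' /asboolP[k mk]
    /asboolP[k' mk'].
  apply: (gap m m' k k' Mm mm'); apply: asym => //.
  by apply: leq_trans m4 _; case/andP: mm'.
(* With [L = ln x / ln 2 >= 1], the number [I + 1] of blocks is at most [2 * L] and the constant
   term is at most itself times [L], so the count is at most [A * L]. *)
pose A : R := (maxn M 4 + 1)%:R + 2 * (2 * B + 1)%:R.
have A0 : 0 < A by rewrite ltr_wpDr ?mulr_ge0 // ltr0n addn1.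
apply/eqO_exP; exists (A / ln 2); first by rewrite divr_gt0 //; lra.
near=> x.
have x2 : 2 <= x by near: x; apply: nbhs_pinfty_ge; exact: num_real.
have x0 : 0 < x by lra.
have lnx : ln 2 <= ln x by rewrite ler_ln ?posrE.
rewrite ger0_norm ?ler0n // ger0_norm; last by lra.
(* [2 ^ I <= x < 2 ^ I.+1]: the left inequality bounds [I] by [ln x / ln 2], the right one puts
   every [m <= x] in [iota 0 (2 ^ I.+1)]. *)
pose I := trunc_log 2 (Num.truncn x).
have tx2 : (2 <= Num.truncn x)%N by rewrite truncn_ge_nat //; lra.
have I_le : I%:R <= ln x / ln 2.
  rewrite ler_pdivlMr; last by lra.
  rewrite mulr_natl -lnXn // ler_ln ?posrE ?exprn_gt0 // -natrX.
  apply: (@le_trans _ _ (Num.truncn x)%:R); last by rewrite truncn_le //; lra.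
  by rewrite ler_nat trunc_logP //; exact: ltnW.
have I1 : 1 <= ln x / ln 2 by rewrite ler_pdivlMr ?mul1r //; lra.
have count_le : (moser_count x <= count P (iota 0 (2 ^ I.+1)))%N.
  rewrite -size_filter /moser_count; apply: uniq_leq_size; first exact: fset_uniq.
  move=> m; rewrite (in_fset_set (finite_moser_upto x)) inE => -[m0 mx [k [_ mk]]].
  rewrite mem_filter mem_iota /= add0n; apply/andP; split.
    by apply/asboolP; exists k.
  apply: leq_ltn_trans (trunc_log_ltn _ (isT : 1 < 2)%N).
  by rewrite truncn_ge_nat //; lra.
have := leq_trans count_le (cnt I.+1).
rewrite -(ler_nat R) => /le_trans; apply.
rewrite natrD natrM -natr1 mulrAC -mulrA.
set L := ln x / ln 2 in I_le I1 *.
have : (I%:R + 1) * (2 * B + 1)%:R <= 2 * L * (2 * B + 1)%:R.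
  by rewrite ler_wpM2r //; lra.
have : (maxn M 4 + 1)%:R <= (maxn M 4 + 1)%:R * L by rewrite ler_peMr.
rewrite /A; lra.
Unshelve. all: by end_near.
Qed.
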